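(* Assume NMA$^-$. Suppose that $\mathfrak A$ is a Boolean algebra such that $\mathfrak B\in\mathsf{SPM}$ for every subalgebra $\mathfrak B$ of $\mathfrak A$ with $|\mathfrak B|<\mathfrak c$. Then $\mathfrak A\in\mathsf{SPM}$.
   Context: $\mathfrak c=2^{\omega}$. For a Boolean algebra $\mathfrak A$, $\mathfrak A\in\mathsf{SPM}$ means that $\mathfrak A$ carries a strictly positive measure, i.e. there is a finitely additive function $\mu:\mathfrak A\to\mathbb R_+$ with $\mu(a)>0$ for every $a\in\mathfrak A\setminus\{0\}$. For a set $X$, $[X]^{<\mathfrak c}$ denotes the family of subsets of $X$ of cardinality $<\mathfrak c$. NMA$^-$ is the assertion: for every set $X$ there is a countably additive probability measure $\lambda$ defined on the power set $\mathcal P([X]^{<\mathfrak c})$ such that $\lambda(\{A\in[X]^{<\mathfrak c}: x\in A\})=1$ for every $x\in X$. *)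

(* Defs.v *)
From HB Require Import structures.
From mathcomp Require Import all_boot all_order all_algebra.
From mathcomp Require Import all_classical all_reals all_analysis.
Set Implicit Arguments.
Unset Strict Implicit.
Unset Printing Implicit Defensive.
Import Order.Theory GRing.Theory Num.Theory.

Local Open Scope classical_set_scope.
Local Open Scope card_scope.
Local Open Scope ring_scope.

Definition card_lt (T U : Type) (A : set T) (B : set U) : Prop :=
  A #<= B /\ ~ (A #= B).

(* |A| < 2^omega *)
Definition lt_continuum (T : Type) (A : set T) : Prop :=
  card_lt A [set: nat -> bool].

(* A Boolean algebra is a [ctbDistrLatticeType]; the degenerate algebra
   (\bot = \top) is allowed. *)
Section BooleanAlgebra.
Local Open Scope order_scope.
Context {d : Order.disp_t}.

(* mu \bot = 0 follows from additivity. *)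
Definition SPM (R : realType) (A : ctbDistrLatticeType d) : Prop :=
  exists mu : A -> R,
    [/\ forall a, (0 <= mu a)%R,
        forall a b, a `&` b = \bot ->
          mu (a `|` b) = (mu a + mu b)%R
      & forall a, a != \bot -> (0 < mu a)%R].

Record subalgebra (A : ctbDistrLatticeType d) := Subalgebra {
  subalg_set :> set A;
  subalg0 : \bot \in subalg_set;
  subalg1 : \top \in subalg_set;
  subalgI : {in subalg_set &, forall a b, a `&` b \in subalg_set};
  subalgU : {in subalg_set &, forall a b, a `|` b \in subalg_set};
  subalgC : {in subalg_set, forall a, ~` a \in subalg_set} }.

Variables (A : ctbDistrLatticeType d) (B : subalgebra A).

(* The elements of B, as a Boolean algebra with the induced operations. *)
Definition subalg_type : Type := {a : A | a \in subalg_set B}.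

HB.instance Definition _ := SubChoice.on subalg_type.
HB.instance Definition _ :=
  Order.SubChoice_isTBSubLattice.Build d A (fun a => a \in subalg_set B) d
    subalg_type (@subalgI A B) (@subalgU A B) (subalg0 B) (subalg1 B).

Lemma subalg_valI : {morph (\val : subalg_type -> A) : x y / x `&` y}.
Proof. by move=> x y; exact: Order.valI_subproof. Qed.

Lemma subalg_valU : {morph (\val : subalg_type -> A) : x y / x `|` y}.
Proof. by move=> x y; exact: Order.valU_subproof. Qed.

Lemma subalg_val0 : \val (\bot : subalg_type) = \bot.
Proof. exact: Order.val0_subproof. Qed.

Lemma subalg_val1 : \val (\top : subalg_type) = \top.
Proof. exact: Order.val1_subproof. Qed.

Let subalg_meetUl :
  @left_distributive subalg_type subalg_type Order.meet Order.join.
Proof.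
by move=> x y z; apply: val_inj; rewrite !(subalg_valI, subalg_valU) meetUl.
Qed.

HB.instance Definition _ :=
  Order.Lattice_Meet_isDistrLattice.Build d subalg_type subalg_meetUl.

Let subalg_compl (x : subalg_type) : subalg_type :=
  Sub (~` val x) (subalgC (valP x)).

Let subalg_joinxC (x : subalg_type) : x `|` subalg_compl x = \top.
Proof. by apply: val_inj; rewrite subalg_valU subalg_val1 SubK joinxC. Qed.

Let subalg_meetxC (x : subalg_type) : x `&` subalg_compl x = \bot.
Proof. by apply: val_inj; rewrite subalg_valI subalg_val0 SubK meetxC. Qed.

HB.instance Definition _ :=
  Order.TBDistrLattice_hasComplement.Build d subalg_type
    subalg_joinxC subalg_meetxC.

Lemma subalg_valC : {morph (\val : subalg_type -> A) : x / ~` x}.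
Proof. by []. Qed.

End BooleanAlgebra.

Section SmallSubsets.
Variable X : Type.

(* The set of subsets of X of cardinality < 2^omega, with its power set as
   sigma-algebra. *)
Definition small_subsets : Type := {A : set X | `[< lt_continuum A >]}.

Let lt_continuum0 : `[< lt_continuum (@set0 X) >].
Proof.
apply/asboolP; split; first exact: card_ge0.
rewrite card_eq_sym; apply/negP; rewrite card_eq0; apply/eqP => /seteqP[+ _].
by move=> /(_ (fun=> true)); exact.
Qed.

HB.instance Definition _ := gen_eqMixin small_subsets.
HB.instance Definition _ := gen_choiceMixin small_subsets.
HB.instance Definition _ :=
  isPointed.Build small_subsets (exist _ (@set0 X) lt_continuum0).
HB.instance Definition _ := @isMeasurable.Build default_measure_display
  small_subsets (@discrete_measurable small_subsets)
  (@discrete_measurable0 small_subsets) (@discrete_measurableC small_subsets)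
  (@discrete_measurableU small_subsets).

End SmallSubsets.

Definition NMA_minus (R : realType) : Prop :=
  forall X : Type, exists lambda : probability (small_subsets X) R,
    forall x : X, lambda [set A | sval A x] = 1%E.

(* Main.v *)
Require Import Defs.
From mathcomp Require Import all_boot all_order all_algebra.
From mathcomp Require Import all_classical all_reals all_analysis.

(** Every S of size < 2^omega generates a subalgebra of size < 2^omega, because
    |I x I| = |I| for infinite I.  It therefore carries a strictly positive
    measure, which is normalized and extended by junk to a function
    m_S : A -> [0, 1].  The measure sought is the average of m_S(a) over S with
    respect to the measure P given by NMA^-: since any fixed a, b lie in P-almost
    every S, additivity and strict positivity of the m_S pass to the average. *)

Import Order.Theory GRing.Theory Num.Theory.
Local Open Scope classical_set_scope.
Local Open Scope card_scope.

(** * Cardinal arithmetic: comparability, and absorption of products and unions by infinite sets *)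

Lemma card_leEx {T : Type} {U : pointedType} {A : set T} {B : set U} :
  A #<= B <-> exists2 f : T -> U, (forall x, A x -> B (f x)) &
    (forall x y, A x -> A y -> f x = f y -> x = y).
Proof.
split=> [/pcard_leP/injfunPex[f fAB finj]|[f fAB finj]].
  by exists f => // x y Ax Ay; apply: finj; rewrite inE.
apply/pcard_leP/injfunPex; exists f => // x y; rewrite !inE.
exact: finj.
Qed.

Lemma card_leX {T T' U U' : Type} {A : set T} {A' : set T'} {B : set U}
    {B' : set U'} :
  A #<= A' -> B #<= B' -> A `*` B #<= A' `*` B'.
Proof.
elim/Ppointed: T' => T' in A' *.
  by rewrite [A']emptyE card_le0 => /eqP->; rewrite set0X.
elim/Ppointed: U' => U' in B' *.
  by rewrite [B']emptyE card_le0 => _ /eqP->; rewrite setX0.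
move=> /card_leEx[f fA fi] /card_leEx[g gB gi]; apply/card_leEx.
exists (fun p => (f p.1, g p.2)) => [[x y] [/= /fA ? /gB ?] //|].
by move=> [x y] [x' y'] [/= Ax By] [/= Ax' By'] [/fi -> // /gi ->].
Qed.

(** Zorn's lemma on graphs of partial injections from [A] to [B]: a maximal one is defined on all of
    [A] or reaches all of [B]. *)
Lemma card_le_total {T U : Type} (A : set T) (B : set U) : A #<= B \/ B #<= A.
Proof.
elim/Ppointed: T => T in A *; first by left; rewrite emptyE.
elim/Ppointed: U => U in B *; first by right; rewrite [B]emptyE.
pose P (G : set (T * U)) := G `<=` A `*` B /\
  forall x x' y y', G (x, y) -> G (x', y') -> x = x' <-> y = y'.
have [F FP tF|G [[GAB Gi] Gmax]] := @Zorn_bigcup _ P.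
  split=> [p [G FG Gp]|x x' y y' [G FG Gp] [G' FG' Gp']].
    exact: (FP _ FG).1.
  have [GG'|GG'] := tF _ _ FG FG'.
    by apply: (FP _ FG').2 => //; exact: GG'.
  by apply: (FP _ FG).2 => //; exact: GG'.
have [domG|/existsNP[a /not_implyP[Aa nGa]]] :=
    pselect (forall a, A a -> exists b, G (a, b)).
  left; apply/card_leEx.
  have [f fG] : {f : T -> U & forall a, A a -> G (a, f a)}.
    apply: (@choice _ _ (fun a b => A a -> G (a, b))) => a.
    by have [/domG[b]|nAa] := pselect (A a); [exists b|exists point].
  exists f => [x /fG/GAB[]//|x y /fG Gx /fG Gy fxy].
  exact/(Gi _ _ _ _ Gx Gy).
have [ranG|/existsNP[b /not_implyP[Bb nGb]]] :=
    pselect (forall b, B b -> exists a, G (a, b)).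
  right; apply/card_leEx.
  have [f fG] : {f : U -> T & forall b, B b -> G (f b, b)}.
    apply: (@choice _ _ (fun b a => B b -> G (a, b))) => b.
    by have [/ranG[a']|nBb] := pselect (B b); [exists a'|exists point].
  exists f => [x /fG/GAB[]//|x y /fG Gx /fG Gy fxy].
  exact/(Gi _ _ _ _ Gx Gy).
(* The points [a] and [b] are both unmatched, so adding the pair would enlarge [G]. *)
exfalso; apply: (Gmax (G `|` [set (a, b)])).
  split=> [p Gp|]; first by left.
  by move=> /(_ (a, b) (or_intror erefl)) Gab; apply: nGa; exists b.
split=> [p [/GAB//|->//]|x x' y y' [Gx|[-> ->]] [Gx'|[-> ->]]] //.
- exact: Gi.
- split=> [xa|yb]; first by case: nGa; exists y; rewrite -xa.
  by case: nGb; exists x; rewrite -yb.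
- split=> [xa|yb]; first by case: nGa; exists y'; rewrite xa.
  by case: nGb; exists x'; rewrite yb.
Qed.

(** The points [u] and [v] serve as tags: [X] goes into the copy of [A] tagged [u], the rest of [Y]
    into the copy tagged [v], and both copies lie in [A * A]. *)
Lemma card_leU {T U : Type} {X Y : set T} {A : set U} (u v : U) :
  A `*` A #<= A -> A u -> A v -> u <> v -> X #<= A -> Y #<= A ->
  X `|` Y #<= A.
Proof.
elim/Ppointed: U => U in A u v *; first by case: (no u).
move=> /card_leEx[f fA fi] Au Av uv /card_leEx[g gA gi] /card_leEx[h hA hi].
apply/card_leEx.
exists (fun x => if pselect (X x) is left _ then f (u, g x) else f (v, h x)).
  move=> x XYx; case: pselect => [Xx|nXx]; apply: fA; split => //=.
    exact: gA.
  by apply: hA; case: XYx.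
have fI a b a' b' : A a -> A b -> A a' -> A b' -> f (a, b) = f (a', b') ->
    a = a' /\ b = b'.
  move=> Aa Ab Aa' Ab' ff.
  by have [] := fi (a, b) (a', b') (conj Aa Ab) (conj Aa' Ab') ff.
move=> x y XYx XYy.
have hA' z : (X `|` Y) z -> ~ X z -> A (h z) by case=> // /hA.
have nX z : (X `|` Y) z -> ~ X z -> Y z by case.
case: pselect => [Xx|nXx]; case: pselect => [Xy|nXy] ff.
- by apply: gi => //; case: (fI _ _ _ _ _ _ _ _ ff) => //; exact: gA.
- by case: (fI _ _ _ _ _ _ _ _ ff) => //; [exact: gA|exact: hA'].
- by case: (fI _ _ _ _ _ _ _ _ ff) => //; [exact: hA'|exact: gA|move=> /esym].
- apply: hi; [exact: nX|exact: nX|].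
  by case: (fI _ _ _ _ _ _ _ _ ff) => //; exact: hA'.
Qed.

Definition pairing_on {T : Type} (Y : set T) (f : T * T -> T) :=
  (forall p, (Y `*` Y) p -> Y (f p)) /\
  (forall p q, (Y `*` Y) p -> (Y `*` Y) q -> f p = f q -> p = q).

(* Hessenberg: a Zorn-maximal injection f : Y x Y -> Y with Y included in A has
   |Y| = |A|; otherwise A \ Y contains a copy of Y, on which the new pairs of an
   extension of f can be coded. *)
Lemma card_le_square {T : Type} (A : set T) :
  infinite_set A -> A `*` A #<= A.
Proof.
elim/Ppointed: T => T in A *; first by rewrite emptyE => /(_ (finite_set0 _)).
move=> /infiniteP/card_leEx[e eA ei].
have e_inj : injective e by move=> m n; exact: ei.
(* Two fixed points are kept in every domain, as tags for [card_leU]. *)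
pose Q (p : set T * (T * T -> T)) :=
  [/\ p.1 `<=` A, p.1 (e 0%N), p.1 (e 1%N) & pairing_on p.1 p.2].
have [f0 f0Q] : exists f0, Q (range e, f0).
  have NN : range e `*` range e #<= range e.
    apply: (@card_le_trans _ _ _ [set: nat]).
      by apply: countableX; exact: card_image_le.
    by apply/card_leEx; exists e => // n _; exists n.
  have /card_leEx[f fN fi] := NN.
  by exists f; split=> [_ [n _ <-]||| ] /=; [exact: eA|exists 0%N|exists 1%N|].
(* Extension of pairings. Values outside the squares are arbitrary, so this is only a preorder. *)
pose le (s t : {p | Q p}) := `[< (sval s).1 `<=` (sval t).1 /\
  forall p, ((sval s).1 `*` (sval s).1) p -> (sval s).2 p = (sval t).2 p >].
have [||F tF|[[Y f] /= [YA Y0 Y1 [fY fi]]] Ymax] :=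
    @ZL_preorder _ (exist _ _ f0Q) le.
- by move=> s; apply/asboolP; split.
- move=> r s t /asboolP[rs rsE] /asboolP[st stE]; apply/asboolP; split.
    exact: subset_trans st.
  by move=> p [p1 p2]; rewrite rsE// stE//; split; exact: rs.
- have [[s0 Fs0]|nF] := pselect (exists s, F s); last first.
    by exists (exist _ _ f0Q) => s Fs; case: nF; exists s.
  pose Y := \bigcup_(s in F) (sval s).1.
  have [f fE] : {f : T * T -> T & forall p s, F s ->
      ((sval s).1 `*` (sval s).1) p -> f p = (sval s).2 p}.
    apply: (@choice _ _ (fun p v => forall s, F s ->
      ((sval s).1 `*` (sval s).1) p -> v = (sval s).2 p)) => p.
    have [[s [Fs sp]]|np] := pselect (exists s, F s /\
        ((sval s).1 `*` (sval s).1) p); last first.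
      by exists point => s Fs sp; case: np; exists s.
    exists ((sval s).2 p) => t Ft tp.
    by case: (tF _ _ Fs Ft) => /asboolP[_ ->].
  (* Both coordinates lie in members of the chain, hence in the larger of the two. *)
  have YYE p : (Y `*` Y) p -> exists2 s, F s & ((sval s).1 `*` (sval s).1) p.
    move=> [[s Fs sp] [t Ft tp]].
    case: (tF _ _ Fs Ft) => /asboolP[st _].
      by exists t => //; split=> //; exact: st.
    by exists s => //; split=> //; exact: st.
  have QY : Q (Y, f).
    split=> [x [s Fs]| | |]/=.
    + by case: s Fs => /= p [pA _ _ _] _; exact: pA.
    + by exists s0 => //; case: s0 Fs0 => /= ? [].
    + by exists s0 => //; case: s0 Fs0 => /= ? [].
    split=> [p /YYE[s Fs sp]|p q /YYE[s Fs sp] /YYE[t Ft tq]].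
      rewrite (fE _ _ Fs sp); exists s => //.
      by case: s Fs sp => /= ? [_ _ _ [+ _]] _; apply.
    have [r Fr [rp rq]] : exists2 r, F r & ((sval r).1 `*` (sval r).1) p /\
        ((sval r).1 `*` (sval r).1) q.
      case: (tF _ _ Fs Ft) => /asboolP[st _]; [exists t|exists s] => //.
        by split=> //; case: sp => ? ?; split; exact: st.
      by split=> //; case: tq => ? ?; split; exact: st.
    rewrite (fE _ _ Fr rp) (fE _ _ Fr rq).
    by case: r Fr rp rq => /= ? [_ _ _ [_ +]] _; exact.
  exists (exist _ _ QY) => s Fs; apply/asboolP; split=> [x sx|p sp] /=.
    by exists s.
  by rewrite (fE _ _ Fs sp).
have YY : Y `*` Y #<= Y by apply/card_leEx; exists f.
have e01 : e 0%N <> e 1%N by move=> /e_inj.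
have leYU X : X #<= Y -> Y `|` X #<= Y.
  by move=> XY; apply: (card_leU _ _ YY Y0 Y1 e01) XY; exact: card_lexx.
(* If the complement is no larger than [Y], then [Y] absorbs it, so [A] injects into [Y] and the
   pairing on [Y] suffices. *)
have [CY|/card_leEx[h hC hi]] := card_le_total (A `\` Y) Y.
  have AY : A #<= Y.
    apply: card_le_trans (leYU _ CY); apply: subset_card_le => x Ax.
    by have [|] := pselect (Y x); [left|right].
  apply: card_le_trans (card_leX AY AY) _; apply: card_le_trans YY _.
  exact: subset_card_le.
exfalso; pose Z := Y `|` h @` Y.
have /card_leEx[k kY ki] : Z #<= Y by apply: leYU; exact: card_image_le.
(* A new pair is moved into [Y] by [k], coded by [f], and sent by [h] outside [Y], where it cannot
   collide with a value of [f] on [Y]. *)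
pose g p := if pselect ((Y `*` Y) p) is left _ then f p
            else h (f (k p.1, k p.2)).
have kYY p : (Z `*` Z) p -> (Y `*` Y) (k p.1, k p.2).
  by move=> [? ?]; split; exact: kY.
have QZ : Q (Z, g).
  split=> /=; [|by left|by left|].
    by move=> x [/YA//|[y /hC[Ahy _] <-]].
  split=> [p Zp|p q Zp Zq]; rewrite /g.
    case: pselect => [Yp|_]; first by left; exact: (fY).
    by right; exists (f (k p.1, k p.2)) => //; exact/fY/kYY.
  case: pselect => [Yp|_]; case: pselect => [Yq|_].
  - exact: (fi).
  - move=> fh; have [_] := hC _ (fY _ (kYY _ Zq)).
    by rewrite -fh => /(_ (fY _ Yp)).
  - move=> fh; have [_] := hC _ (fY _ (kYY _ Zp)).
    by rewrite fh => /(_ (fY _ Yq)).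
  move=> /hi-/(_ (fY _ (kYY _ Zp)) (fY _ (kYY _ Zq))).
  move=> /fi-/(_ (kYY _ Zp) (kYY _ Zq)).
  case: p q Zp Zq => [x y] [x' y'] [/= Zx Zy] [/= Zx' Zy'] [kx ky].
  by congr (_, _); exact: ki.
have /Ymax/asboolP[/= ZY _] :
    le (exist _ _ (And4 YA Y0 Y1 (conj fY fi))) (exist _ _ QZ).
  apply/asboolP; split=> /= [x Yx|p Yp]; first by left.
  by rewrite /g; case: pselect.
(* Maximality puts [Z] inside [Y], although [h (e 0)] belongs to [Z] and not to [Y]. *)
have [_] := hC _ Y0; apply; apply: ZY; right; exact/imageP.
Qed.

(** A point is coded by an index [n] of some [F n] containing it and its image under an injection of
    [F n] into [I]; then [I * I] is absorbed by [I]. *)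
Lemma card_le_bigcup {T U : Type} (F : nat -> set T) (I : set U) :
  infinite_set I -> (forall n, F n #<= I) -> \bigcup_n F n #<= I.
Proof.
elim/Ppointed: U => U in I *; first by rewrite emptyE => /(_ (finite_set0 _)).
move=> Iinf FI; apply: card_le_trans (@card_le_square _ _ Iinf).
have leX : [set: nat] `*` I #<= I `*` I.
  by apply: card_leX; [exact/infiniteP|exact: card_lexx].
apply: card_le_trans leX; apply/card_leEx.
have /choice[f fP] : forall n, exists f : T -> U,
    (forall x, F n x -> I (f x)) /\
    (forall x y, F n x -> F n y -> f x = f y -> x = y).
  by move=> n; have /card_leEx[f] := FI n; exists f.
have /choice[r rP] : forall x, exists n, (\bigcup_n F n) x -> F n x.
  by move=> x; have [[n _ Fn]|] := pselect ((\bigcup_n F n) x);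
    [exists n|exists 0%N].
exists (fun x => (r x, f (r x) x)) => [x /rP Fx|x y /rP Fx /rP Fy [rxy]].
  by split=> //=; exact: (fP _).1.
by rewrite -rxy in Fy *; exact: (fP _).2.
Qed.

Lemma card_lt_le_trans {T U V : Type} (A : set T) (B : set U) (C : set V) :
  A #<= B -> card_lt B C -> card_lt A C.
Proof.
move=> AB [BC nBC]; split; first exact: card_le_trans BC.
by rewrite card_eq_le => /andP[_ CA]; apply: nBC;
  rewrite card_eq_le BC (card_le_trans CA AB).
Qed.

Lemma lt_continuum_nat : lt_continuum [set: nat].
Proof.
split.
  apply/card_leEx; exists (fun n k => n == k) => // m n _ _ /(congr1 (@^~ m)).
  by rewrite eqxx => /esym/eqP.
rewrite card_eq_le => /andP[_ /card_leEx[f _ fi]].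
(* Cantor's diagonal set read through the injection [f]: both [D (f D)] and its negation are
   contradictory. *)
pose D n := `[< exists b, f b = n /\ ~~ b n >].
have [DfD|] := boolP (D (f D)); last first.
  by move=> nD; move/asboolP: (nD); apply; exists D.
have /asboolP[b [/fi bD nb]] := DfD.
by move: nb; rewrite bD// DfD.
Qed.

Lemma infinite_card_leU {T U : Type} (X Y : set T) (I : set U) :
  infinite_set I -> X #<= I -> Y #<= I -> X `|` Y #<= I.
Proof.
elim/Ppointed: U => U in I *; first by rewrite emptyE => /(_ (finite_set0 _)).
move=> Iinf; have /infiniteP/card_leEx[e eI ei] := Iinf.
apply: (card_leU (e 0%N) (e 1%N) (@card_le_square _ _ Iinf)); do ?exact: eI.
by move=> /ei -/(_ Logic.I Logic.I).
Qed.

(** * Subalgebras generated by small sets *)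

Section GeneratedSubalgebra.
Local Open Scope order_scope.
Context {d : Order.disp_t} {A : ctbDistrLatticeType d}.

(** This one operation yields all the Boolean ones, so the closure has a single kind of generation
    step. *)
Definition nand (p : A * A) : A := ~` (p.1 `&` p.2).

Fixpoint nand_level (S : set A) (n : nat) : set A :=
  if n is m.+1 then
    (nand_level S m `|` nand @` (nand_level S m `*` nand_level S m))%classic
  else ([set \bot] `|` S)%classic.

Definition nand_closure (S : set A) : set A := \bigcup_n nand_level S n.

(** The levels increase, so two elements of the closure share a level, and the next level contains
    their [nand]. *)
Lemma nand_closureP S x y : nand_closure S x -> nand_closure S y ->
  nand_closure S (~` (x `&` y)).
Proof.
have le m n : (m <= n)%N -> (nand_level S m `<=` nand_level S n)%classic.
  elim: n => [|n IHn]; first by rewrite leqn0 => /eqP->.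
  by rewrite leq_eqVlt => /predU1P[->//|/IHn mn z /mn]; left.
move=> [m _ mx] [n _ ny]; exists (maxn m n).+1 => //; right.
exists (x, y) => //; split.
  by apply: le mx; exact: leq_maxl.
by apply: le ny; exact: leq_maxr.
Qed.

Lemma nand_closure0 S : nand_closure S \bot.
Proof. by exists 0%N => //; left. Qed.

Lemma nand_closureC S x : nand_closure S x -> nand_closure S (~` x).
Proof. by move=> Sx; have := nand_closureP _ _ _ Sx Sx; rewrite meetxx. Qed.

Lemma nand_closureI S x y : nand_closure S x -> nand_closure S y ->
  nand_closure S (x `&` y).
Proof.
by move=> Sx /(nand_closureP _ _ _ Sx)/nand_closureC; rewrite complK.
Qed.

Lemma nand_closureU S x y : nand_closure S x -> nand_closure S y ->
  nand_closure S (x `|` y).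
Proof.
move=> /nand_closureC Sx /nand_closureC /(nand_closureP _ _ _ Sx).
by rewrite complI !complK.
Qed.

Program Definition generated_subalgebra (S : set A) : subalgebra A :=
  @Subalgebra _ _ (nand_closure S) _ _ _ _ _.
Next Obligation. by move=> S; rewrite inE; exact: nand_closure0. Qed.
Next Obligation.
by move=> S; rewrite inE -compl0; apply/nand_closureC/nand_closure0.
Qed.
Next Obligation. by move=> S x y; rewrite !inE; exact: nand_closureI. Qed.
Next Obligation. by move=> S x y; rewrite !inE; exact: nand_closureU. Qed.
Next Obligation. by move=> S x; rewrite !inE; exact: nand_closureC. Qed.

Lemma sub_generated_subalgebra S : (S `<=` generated_subalgebra S)%classic.
Proof. by move=> x Sx; exists 0%N => //; right. Qed.

Lemma card_nand_closure {U : Type} (S : set A) (I : set U) :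
  infinite_set I -> S #<= I -> nand_closure S #<= I.
Proof.
move=> Iinf SI; apply: card_le_bigcup => //; elim=> [|n IHn] /=.
  apply: infinite_card_leU => //.
  by move/infiniteP: Iinf; apply: card_le_trans; exact: countable1.
apply: infinite_card_leU => //; apply: card_le_trans (card_image_le _ _) _.
exact: card_le_trans (card_leX IHn IHn) (card_le_square _ Iinf).
Qed.

(** An infinite [S] bounds its own closure; for finite [S] the closure is countable. *)
Lemma lt_continuum_generated_subalgebra (S : set A) :
  lt_continuum S -> lt_continuum (generated_subalgebra S).
Proof.
move=> Sc; have [fS|iS] := pselect (finite_set S); last first.
  by apply: card_lt_le_trans Sc; exact: card_nand_closure.
apply: card_lt_le_trans lt_continuum_nat; apply: card_nand_closure.
  exact: infinite_nat.
exact: finite_set_countable.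
Qed.

End GeneratedSubalgebra.

(** * Normalized measures and their average *)

Section Averaging.
Local Open Scope ring_scope.
Context {R : realType} {d : Order.disp_t} {A : ctbDistrLatticeType d}.

(** The bounds hold on all of [A], so that for fixed [a] the average is over a bounded function of
    [S]; only additivity and positivity are confined to [S]. *)
Definition partial_measure (S : set A) (m : A -> R) :=
  [/\ forall a, 0 <= m a <= 1,
      forall a b, S a -> S b -> (a `&` b = \bot)%O ->
        m (a `|` b)%O = m a + m b
    & forall a, S a -> a != \bot%O -> 0 < m a].

(** Divide [mu] by [mu \top], which bounds it by additivity, and take the value 0 off [B]. *)
Lemma SPM_partial_measure (B : subalgebra A) :
  SPM R (subalg_type B) -> exists m, partial_measure B m.
Proof.
move=> [mu [mu0 muU mu_gt0]].
have mu_le1 a : mu a <= mu \top%O.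
  by rewrite -(joinxC a) muU ?meetxC// lerDl.
pose m (a : A) := if insub a is Some b then mu b / mu \top%O else 0.
have mE (a : subalg_type B) : m (val a) = mu a / mu \top%O.
  by rewrite /m valK.
exists m; split=> [a|a b /mem_set Ba /mem_set Bb ab|a /mem_set Ba a0].
- rewrite /m; case: insubP => [b _ _|_]; last by rewrite lexx ler01.
  rewrite divr_ge0//=; have [->|mu1] := eqVneq (mu \top%O) 0.
    (* A is degenerate *)
    by rewrite invr0 mulr0 ler01.
  by rewrite ler_pdivrMr ?mul1r// lt_def mu1 mu0.
- rewrite -[a](SubK (subalg_type B) Ba) -[b](SubK (subalg_type B) Bb).
  rewrite -subalg_valU !mE muU ?mulrDl//.
  by apply: val_inj; rewrite subalg_valI subalg_val0 !SubK.
rewrite -[a](SubK (subalg_type B) Ba) mE.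
set b := Sub a Ba; have b_gt0 : 0 < mu b.
  apply: mu_gt0; apply: contra_neq a0 => /(congr1 val).
  by rewrite subalg_val0 SubK.
by rewrite divr_gt0// (lt_le_trans b_gt0).
Qed.

End Averaging.

Theorem theorem2p2 (R : realType) (d : Order.disp_t)
    (A : ctbDistrLatticeType d) :
  NMA_minus R ->
  (forall B : subalgebra A, lt_continuum (subalg_set B) ->
     SPM R (subalg_type B)) ->
  SPM R A.
Proof.
move=> /(_ A)[P PA] smallSPM.
have /choice[m mP] : forall S : small_subsets A, exists m : A -> R,
    partial_measure (sval S) m.
  move=> [S /= /asboolP Sc].
  have /smallSPM/SPM_partial_measure[m [m01 mU m_gt0]] :=
    lt_continuum_generated_subalgebra _ Sc.
  have sub := sub_generated_subalgebra S.
  by exists m; split=> [//|a b /sub Sa /sub|a /sub]; [exact: mU|exact: m_gt0].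
have m_ge0 S a : (0 <= m S a)%R by have [/(_ a)/andP[]] := mP S.
(* Every function on [small_subsets A] is measurable, the sigma-algebra being the full power set;
   values in [0, 1] then give integrability. *)
have intm a : P.-integrable setT (EFin \o m ^~ a).
  apply: measurable_bounded_integrable => //=.
    by rewrite probability_setT ltry.
  exists 1%R; split=> [|r r1 S _]; first exact: num_real.
  have [/(_ a)/andP[_ m1] _ _] := mP S.
  by rewrite /= ger0_norm// (le_trans m1)// ltW.
have aeP (a : A) : {ae P, forall S, sval S a}.
  exists (~` [set S | sval S a]); split=> //.
  by rewrite probability_setC// PA subee.
exists (fun a => Rintegral P setT (m ^~ a)); split=> [a|a b ab|a a0].
- exact: Rintegral_ge0.
(* Almost every [S] contains both [a] and [b], so the integrands agree almost everywhere. *)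
- rewrite -RintegralD// /Rintegral; congr fine; apply: ae_eq_integral => //.
  near=> S => _ /=.
  have [_ mU _] := mP S; rewrite mU//; near: S; exact: aeP.
(* If the average at [a] vanished, the nonnegative [m S a] would be 0 for almost every [S], while it
   is positive whenever [S] contains [a]. *)
rewrite lt_neqAle Rintegral_ge0// andbT; apply/eqP => /esym mu0.
have int0 : (\int[P]_S `|(m S a)%:E| = 0)%E.
  under eq_integral do rewrite abse_EFin ger0_norm//.
  by rewrite -[LHS]fineK ?[fine _]mu0// (integrable_fin_num _ (intm a)).
have [//|/(_ int0) aem0 _] :=
  @ae_eq_integral_abs _ _ _ P _ measurableT (EFin \o m ^~ a).
have m0 : {ae P, forall S, m S a = 0%R}.
  by apply: filterS aem0 => S /(_ Logic.I)[].
have : {ae P, forall S : small_subsets A, False}.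
  near=> S; have [_ _ m_gt0] := mP S.
  have Sa : sval S a by near: S; exact: aeP.
  suff mS0 : m S a = 0%R by have := m_gt0 a Sa a0; rewrite mS0 ltxx.
  by near: S.
(* A property false everywhere but true almost everywhere makes the whole space null, against total
   mass 1. *)
move=> [N [_ N0 allN]]; have : P setT = 0%E.
  by apply/eqP; rewrite -measure_le0 -N0 le_measure ?inE// => S _; exact: allN.
by rewrite probability_setT => -[] /eqP; rewrite oner_eq0.
Unshelve. all: by end_near.
Qed.
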